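(* Let $G$ be a finite, simple, connected graph which is not a tree, not a cycle, and not isomorphic to any of the graphs $Y_{abc}$. Then there exist uncountably many evasive walks on $G$ which visit each vertex of $G$ infinitely many times.
   Context: For integers $a,b,c\ge 0$, $Y_{abc}$ denotes the graph consisting of a triangle with a path of length $a$, a path of length $b$ and a path of length $c$ attached (by an endpoint) to its three vertices respectively. A walk on $G$ is an infinite sequence $R(1),R(2),\ldots$ of vertices with $R(i)$ adjacent to $R(i+1)$ for all $i$. A random walk on $G$: $R(1)$ uniform among vertices, each $R(i+1)$ uniform among neighbours of $R(i)$. For walks $R,S$, tokens $T_R,T_S$ start at $R(1),S(1)$; a move advances exactly one token one step along its own walk. The pair $(R,S)$ is successful if there is an infinite sequence of moves in which each token is advanced infinitely often and the tokens never occupy the same vertex simultaneously (including initially). A walk $S$ is evasive if for a random walk $R$ on $G$, $(R,S)$ is successful with positive probability. *)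

(* Defs.v *)
From HB Require Import structures.
From mathcomp Require Import all_boot all_order all_algebra.
From mathcomp Require Import all_classical all_reals all_analysis.

Set Implicit Arguments.
Unset Strict Implicit.
Unset Printing Implicit Defensive.

Import Order.TTheory GRing.Theory Num.Theory.
Local Open Scope classical_set_scope.
Local Open Scope ring_scope.

(* A finite simple graph is a finType V of vertices together with a symmetric
   irreflexive adjacency relation e : rel V. *)

Definition simple_graph (V : finType) (e : rel V) : Prop :=
  symmetric e /\ irreflexive e.

Definition connected_graph (V : finType) (e : rel V) : Prop :=
  (0 < #|V|)%N /\ forall x y : V, connect e x y.

(* The bound 2 < size c excludes an edge traversed back and forth, which is a
   duplicate-free e-cycle in the sense of ucycleb. *)
Definition acyclic_graph (V : finType) (e : rel V) : Prop :=
  forall c : seq V, (2 < size c)%N -> ~~ ucycleb e c.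

Definition is_tree (V : finType) (e : rel V) : Prop :=
  connected_graph e /\ acyclic_graph e.

Definition graph_isomorphic (V W : finType) (e : rel V) (e' : rel W) : Prop :=
  exists2 f : V -> W, bijective f & forall x y : V, e' (f x) (f y) = e x y.

Definition cycle_adj (n : nat) : rel 'I_n :=
  fun i j => (j == ordS i) || (i == ordS j).

Definition is_cycle_graph (V : finType) (e : rel V) : Prop :=
  exists2 n : nat, (2 < n)%N & graph_isomorphic e (@cycle_adj n).

Definition Y_length (a b c : nat) (i : 'I_3) : nat := nth 0%N [:: a; b; c] i.

(* The vertex (i, k) lies at distance k from the triangle along the i-th path;
   the i-th triangle vertex is (i, 0), which is also an end of the i-th path,
   so that a path of length l contributes l additional vertices. *)
Definition Y_vertex (a b c : nat) : finType :=
  {i : 'I_3 & 'I_(Y_length a b c i).+1}.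

Definition Y_adj (a b c : nat) : rel (Y_vertex a b c) := fun u v =>
  let k : nat := tagged u in let l : nat := tagged v in
  if tag u == tag v then (l == k.+1) || (k == l.+1)
  else (k == 0%N) && (l == 0%N).

(* Walks are indexed from 0. *)
Definition is_walk (V : finType) (e : rel V) (S : nat -> V) : Prop :=
  forall n : nat, e (S n) (S n.+1).

(* A sequence of moves is m : nat -> bool: the k-th move advances the first
   token if m k is true, and the second token otherwise. *)
Definition moves_first (m : nat -> bool) (k : nat) : nat :=
  (\sum_(i < k) m i)%N.

Definition moves_second (m : nat -> bool) (k : nat) : nat :=
  (\sum_(i < k) ~~ m i)%N.

Definition successful (V : finType) (T S : nat -> V) : Prop :=
  exists m : nat -> bool,
    [/\ forall n : nat, exists2 k : nat, (n <= k)%N & m k,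
        forall n : nat, exists2 k : nat, (n <= k)%N & ~~ m k
      & forall k : nat, T (moves_first m k) <> S (moves_second m k)].

Definition degree (V : finType) (e : rel V) (x : V) : nat :=
  #|[pred y | e x y]|.

Section RandomWalk.
Context {R : realType} {d : measure_display} {Omega : measurableType d}.
Variable P : probability Omega R.

(* The last clause is the transition rule, conditionally on the whole past
   h 0, ..., h n, in the product form that remains meaningful when the past
   has probability zero. *)
Definition random_walk (V : finType) (e : rel V) (X : nat -> Omega -> V) :
    Prop :=
  [/\ forall (n : nat) (v : V), measurable [set w | X n w = v],
      forall v : V, P [set w | X 0%N w = v] = (#|V|%:R^-1)%:E
    & forall (n : nat) (h : nat -> V) (v : V),
        P [set w | (forall i, (i <= n)%N -> X i w = h i) /\ X n.+1 w = v] =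
        (P [set w | forall i, (i <= n)%N -> X i w = h i] *
         (if e (h n) v then (degree e (h n))%:R^-1 else 0)%:E)%E].

(* P is only meaningful on measurable sets, so positivity is expressed through
   the inner measure; it is plain positivity on measurable sets, see
   positive_probabilityE. *)
Definition positive_probability (A : set Omega) : Prop :=
  exists E : set Omega, [/\ measurable E, E `<=` A & (0 < P E)%E].

Lemma positive_probabilityE (A : set Omega) : measurable A ->
  positive_probability A <-> (0 < P A)%E.
Proof.
move=> mA; split=> [[E [mE EA PE]]|PA]; last by exists A; split.
by apply: (lt_le_trans PE); rewrite le_measure ?inE.
Qed.

End RandomWalk.

Definition evasive (R : realType) (V : finType) (e : rel V) (S : nat -> V) :
    Prop :=
  forall (d : measure_display) (Omega : measurableType d)
    (P : probability Omega R) (X : nat -> Omega -> V),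
    random_walk P e X ->
    positive_probability P [set w | successful (fun n => X n w) S].

(* Main.v *)
Require Import Defs.
From mathcomp Require Import all_boot all_order all_algebra.
From mathcomp Require Import all_classical all_reals all_analysis.

(** Let C be a shortest cycle and p a vertex off C; such a p exists, since
   otherwise C would be a Hamiltonian cycle without chords. A token confined to C
   can dodge an arbitrary sequence of positions of the other token, because at
   least one of its two neighbours on C is free. Hence, with c on C,
   - every word W leading the random token from p back to p has an answer: a
     closed walk at c inside C that can be interleaved with W. It can also be
     run through while the random token waits at p;
   - there are closed walks u at p and w at c, compatible with each other, such
     that w visits every vertex: let the token on C dodge while the other one
     enters C, then exchange roles while the former walks to the desired vertex,
     and finally undo everything.
   The evasive walk is a concatenation of blocks; the n-th block consists of
   answers to all words of length at most t (n+1), followed by w. If a walk starts at p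
   and contains u between the times t n and t (n+1) for every n, then it cuts
   into words W u, and the n-th of them is compatible with the n-th block. For t
   growing fast enough this has positive probability by a union bound. A
   bit of freedom at the start of each block gives uncountably many walks. *)

Set Implicit Arguments.
Unset Strict Implicit.
Unset Printing Implicit Defensive.

Local Open Scope classical_set_scope.

(** * Infinite concatenations of finite words *)

Section InfiniteConcatenation.
Local Open Scope nat_scope.

(* Junk if some word is empty: the first [k] words must contain [k] letters. *)
Definition concat_walk (T : Type) (x : T) (w : nat -> seq T) (k : nat) : T :=
  nth x (x :: flatten (mkseq w k)) k.

Definition block_start (T : Type) (w : nat -> seq T) (n : nat) : nat :=
  size (flatten (mkseq w n)).

Lemma flatten_mkseqS (T : Type) (w : nat -> seq T) n :
  flatten (mkseq w n.+1) = flatten (mkseq w n) ++ w n.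
Proof. by rewrite mkseqS flatten_rcons. Qed.

Lemma block_startS (T : Type) (w : nat -> seq T) n :
  block_start w n.+1 = block_start w n + size (w n).
Proof. by rewrite /block_start flatten_mkseqS size_cat. Qed.

Lemma flatten_mkseq_prefix (T : Type) (w : nat -> seq T) m n : m <= n ->
  exists s, flatten (mkseq w n) = flatten (mkseq w m) ++ s.
Proof.
elim: n => [|n IHn]; first by rewrite leqn0 => /eqP->; exists [::].
rewrite leq_eqVlt => /predU1P[->|]; first by exists [::]; rewrite cats0.
by move=> /IHn[s E]; exists (s ++ w n); rewrite flatten_mkseqS E catA.
Qed.

Section NonemptyWords.
Variables (T : Type) (x : T) (w : nat -> seq T).
Hypothesis w_nonempty : forall n, 0 < size (w n).

Lemma leq_block_start n : n <= block_start w n.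
Proof.
elim: n => // n IHn; rewrite block_startS -addn1.
by rewrite leq_add.
Qed.

Lemma concat_walkE n k : k <= block_start w n ->
  concat_walk x w k = nth x (x :: flatten (mkseq w n)) k.
Proof.
case: k => // k kn.
change (nth x (flatten (mkseq w k.+1)) k = nth x (flatten (mkseq w n)) k).
have [nk|/ltnW kn'] := leqP n k.+1.
  by have [s ->] := flatten_mkseq_prefix w nk; rewrite nth_cat kn.
have [s ->] := flatten_mkseq_prefix w kn'; rewrite nth_cat.
by rewrite [_ < _]leq_block_start.
Qed.

Lemma concat_walk_block n i : i < size (w n) ->
  concat_walk x w (block_start w n + i).+1 = nth x (w n) i.
Proof.
move=> iw; rewrite (@concat_walkE n.+1) ?block_startS -?addnS ?leq_add2l // addnS.
rewrite -[LHS]/(nth x (flatten (mkseq w n.+1)) _).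
rewrite flatten_mkseqS nth_cat ltnNge leq_addr /=.
by rewrite -/(block_start w n) addnC addnK.
Qed.

Lemma last_flatten_mkseq n : (forall k, last x (w k) = x) ->
  last x (flatten (mkseq w n)) = x.
Proof. by move=> wx; elim: n => // n IHn; rewrite flatten_mkseqS last_cat IHn. Qed.

(** Since all words end at [x], each block also starts from [x]; this lets [i = 0] join the uniform
    formula. *)
Lemma concat_walk_closed_block n i : (forall k, last x (w k) = x) ->
  i <= size (w n) ->
  concat_walk x w (block_start w n + i) = nth x (x :: w n) i.
Proof.
case: i => [|i] wx iw; last by rewrite addnS concat_walk_block.
by rewrite addn0 (concat_walkE (leqnn _)) nth_last /= last_flatten_mkseq.
Qed.

Lemma mkseq_concat_walk n :
  mkseq (fun k => concat_walk x w k.+1) (block_start w n) = flatten (mkseq w n).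
Proof.
apply: (@eq_from_nth _ x); rewrite size_mkseq // => k kn.
by rewrite nth_mkseq // (concat_walkE kn).
Qed.

End NonemptyWords.

Lemma concat_walk_is_walk (V : finType) (e : rel V) x (w : nat -> seq V) :
  (forall n, 0 < size (w n)) -> (forall n, last x (w n) = x) ->
  (forall n, path e x (w n)) -> is_walk e (concat_walk x w).
Proof.
move=> w0 wx we k.
have pn n : path e x (flatten (mkseq w n)).
  by elim: n => // n IHn; rewrite flatten_mkseqS cat_path IHn last_flatten_mkseq // we.
have kb : k.+1 <= block_start w k.+1 by exact: leq_block_start.
rewrite !(@concat_walkE _ _ _ w0 k.+1) //; last exact: ltnW.
exact: (pathP x (pn _)).
Qed.

(** Brings a walk cut at chosen times into the block form required by [evades_successful]. The
    letter at time [t n] closes the previous word, so the [n]-th word starts one step later. *)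
Lemma cut_into_words (T : Type) (x : nat -> T) (t : nat -> nat) (w : nat -> seq T) :
  t 0 = 0 -> (forall n, t n < t n.+1) ->
  (forall n, w n = [seq x k | k <- iota (t n).+1 (t n.+1 - t n)]) ->
  x = concat_walk (x 0) w.
Proof.
move=> t0 tS wE.
have w0 n : 0 < size (w n) by rewrite wE size_map size_iota subn_gt0.
have tE n : block_start w n = t n.
  elim: n => // n; rewrite block_startS wE size_map size_iota => ->.
  by rewrite subnKC // ltnW.
have fE n : flatten (mkseq w n) = [seq x k | k <- iota 1 (t n)].
  elim: n => [|n IHn]; first by rewrite t0.
  rewrite flatten_mkseqS IHn wE -map_cat -add1n -iotaD subnKC // ltnW //.
apply/funext => k.
rewrite (concat_walkE _ w0 (leq_block_start w0 k)) fE.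
case: k => // k /=.
have kt : k < t k.+1 by rewrite -tE; apply: leq_block_start.
by rewrite (nth_map 0) ?size_iota // nth_iota // add1n.
Qed.

End InfiniteConcatenation.

(** * Compatible words and schedules of moves *)

Section Evasion.
Local Open Scope nat_scope.
Variables (V : finType) (e : rel V).

(* [evades r s u v]: the moves of two tokens, placed at [r] and [s] and
   following the words [u] and [v], can be interleaved without collision.
   No adjacency is required here. *)
Inductive evades : V -> V -> seq V -> seq V -> Prop :=
| EvadesNil r s of r != s : evades r s [::] [::]
| EvadesFirst r s r' u v of r != s & evades r' s u v : evades r s (r' :: u) v
| EvadesSecond r s s' u v of r != s & evades r s' u v : evades r s u (s' :: v).

Lemma evades_neq r s u v : evades r s u v -> r != s.
Proof. by case. Qed.

Lemma evades_last_neq r s u v : evades r s u v -> last r u != last s v.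
Proof. by elim. Qed.

Lemma evades_cat r s u v u' v' : evades r s u v ->
  evades (last r u) (last s v) u' v' -> evades r s (u ++ u') (v ++ v').
Proof.
by elim=> // *; [apply: EvadesFirst|apply: EvadesSecond]; auto.
Qed.

Lemma evades_sym r s u v : evades r s u v -> evades s r v u.
Proof.
by elim=> *; [apply: EvadesNil|apply: EvadesSecond|apply: EvadesFirst];
  rewrite // eq_sym.
Qed.

Lemma last_rev_belast (r : V) u : last (last r u) (rev (belast r u)) = r.
Proof. by case: u => //= a u; rewrite rev_cons last_rcons. Qed.

(** Run the schedule backwards: [rev (belast r u)] is the route back to [r], and the first move of
    the schedule becomes the last one of the reversed schedule. *)
Lemma evades_rev r s u v : evades r s u v ->
  evades (last r u) (last s v) (rev (belast r u)) (rev (belast s v)).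
Proof.
elim=> [*|{}r {}s r' {}u {}v rs ev IH|{}r {}s s' {}u {}v rs ev IH] /=.
- exact: EvadesNil.
- rewrite rev_cons -cats1 -[rev (belast s v)]cats0; apply: evades_cat => //.
  rewrite !last_rev_belast; apply: EvadesFirst (evades_neq ev) _.
  exact: EvadesNil.
- rewrite rev_cons -cats1 -[rev (belast r u)]cats0; apply: evades_cat => //.
  rewrite !last_rev_belast; apply: EvadesSecond (evades_neq ev) _.
  exact: EvadesNil.
Qed.

Lemma evades_still r s v : r \notin s :: v -> evades r s [::] v.
Proof.
elim: v s => [|s' v IHv] s; rewrite inE ?orbF => rn; first exact: EvadesNil.
move: rn; rewrite negb_or => /andP[rs rv].
by apply: EvadesSecond => //; apply: IHv.
Qed.

Lemma evades_nil_notin r s v : evades r s [::] v -> r \notin s :: v.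
Proof.
elim: v s => [|s' v IHv] s ev; first by rewrite inE (evades_neq ev).
by rewrite inE negb_or (evades_neq ev) IHv //; inversion ev.
Qed.

Lemma evades_moves r s u v : evades r s u v -> exists m : seq bool,
  [/\ count id m = size u, count negb m = size v
    & forall k, nth r (r :: u) (count id (take k m)) !=
                nth s (s :: v) (count negb (take k m))].
Proof.
elim=> [{}r {}s rs|{}r {}s r' {}u {}v rs _ [m [mu mv mk]]
  |{}r {}s s' {}u {}v rs _ [m [mu mv mk]]].
- by exists [::].
- exists (true :: m); split=> /=; rewrite ?mu ?mv // => -[|k] //=.
  rewrite ?add0n ?add1n.
  have := mk k; set i := count _ _; set j := count _ _.
  (* The index stays in range, so changing the default of [nth] from [r'] to [r] is harmless. *)
  have iu : i < size (r' :: u).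
    by rewrite /= ltnS -mu -[in leqRHS](cat_take_drop k m) count_cat leq_addr.
  by rewrite (set_nth_default r' r iu).
- exists (false :: m); split=> /=; rewrite ?mu ?mv // => -[|k] //=.
  rewrite ?add0n ?add1n.
  have := mk k; set i := count _ _; set j := count _ _.
  have jv : j < size (s' :: v).
    by rewrite /= ltnS -mv -[in leqRHS](cat_take_drop k m) count_cat leq_addr.
  by rewrite (set_nth_default s' s jv).
Qed.

Lemma moves_firstE m k : moves_first m k = count id (mkseq m k).
Proof.
elim: k => [|k IHk]; first by rewrite /moves_first big_ord0.
by rewrite /moves_first big_ord_recr -/(moves_first m k) IHk mkseqS
  -cats1 count_cat /= addn0.
Qed.

Lemma moves_secondE m k : moves_second m k = count negb (mkseq m k).
Proof.
elim: k => [|k IHk]; first by rewrite /moves_second big_ord0.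
by rewrite /moves_second big_ord_recr -/(moves_second m k) IHk mkseqS
  -cats1 count_cat /= addn0.
Qed.

Lemma count_block_start (a : pred bool) (M : nat -> seq bool) (u : nat -> seq V) n :
  (forall n, count a (M n) = size (u n)) ->
  count a (flatten (mkseq M n)) = block_start u n.
Proof.
move=> Mu; elim: n => // n IHn.
by rewrite flatten_mkseqS count_cat IHn Mu block_startS.
Qed.

(** All words being closed, the finite schedules from [evades_moves] can be played one after
    another. *)
Lemma evades_successful p c (u v : nat -> seq V) :
  (forall n, 0 < size (u n)) -> (forall n, 0 < size (v n)) ->
  (forall n, last p (u n) = p) -> (forall n, last c (v n) = c) ->
  (forall n, evades p c (u n) (v n)) ->
  successful (concat_walk p u) (concat_walk c v).
Proof.
move=> u0 v0 up vc uv.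
have /choice[M MP] := fun n => evades_moves (uv n).
have M0 n : 0 < size (M n).
  case: (MP n) => Mu _ _; apply: leq_trans (count_size id _); by rewrite Mu.
(* Shifted by one, because index 0 of [concat_walk] holds the base letter, which is not a move. *)
pose m k := concat_walk false M k.+1.
have mE n : mkseq m (block_start M n) = flatten (mkseq M n).
  exact: mkseq_concat_walk.
have inf (a : pred bool) : (forall n, 0 < count a (M n)) ->
    forall n, exists2 k, n <= k & a (m k).
  move=> aM n.
  have : has a (M n) by rewrite has_count.
  move=> /(has_nthP false)[i iM ai].
  exists (block_start M n + i).
    exact: leq_trans (leq_block_start M0 n) (leq_addr _ _).
  by rewrite /m concat_walk_block.
exists m; split.
- by apply: (inf id) => n; case: (MP n) => ->.
- by apply: (inf negb) => n; case: (MP n) => _ ->.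
move=> k; rewrite moves_firstE moves_secondE.
(* Induction on the number of blocks reduces to a [k] inside one block, where a prefix of [M n] has
   been played. *)
suff main n : k <= block_start M n ->
    concat_walk p u (count id (mkseq m k)) <>
    concat_walk c v (count negb (mkseq m k)).
  exact: main (leq_block_start M0 k).
elim: n => [|n IHn kn].
  rewrite leqn0 => /eqP->; apply/eqP; exact: evades_neq (uv 0).
have [/IHn //|nk] := leqP k (block_start M n).
have [Mu Mv Mk] := MP n.
have -> : mkseq m k = flatten (mkseq M n) ++ take (k - block_start M n) (M n).
  have -> : mkseq m k = take k (flatten (mkseq M n.+1)).
    by rewrite -mE -map_take take_iota (minn_idPl kn).
  rewrite flatten_mkseqS take_cat -/(block_start M n) ifN //.
  by rewrite -leqNgt ltnW.
move: (k - _) => j; apply/eqP; rewrite !count_cat.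
rewrite (@count_block_start id M u) => [|i]; last by case: (MP i).
rewrite (@count_block_start negb M v) => [|i]; last by case: (MP i).
rewrite !concat_walk_closed_block //.
  by rewrite -Mv -[in leqRHS](cat_take_drop j (M n)) count_cat leq_addr.
by rewrite -Mu -[in leqRHS](cat_take_drop j (M n)) count_cat leq_addr.
Qed.

End Evasion.

(** * Cycles and their chords *)

Section Cycles.
Local Open Scope nat_scope.
Variables (V : finType) (e : rel V).
Hypotheses (e_sym : symmetric e) (e_irr : irreflexive e).

(** The successor and the predecessor of [s] on [C] are distinct as [C] has length at least 3. *)
Lemma cycle_two_neighbours (C : seq V) s : ucycleb e C -> 2 < size C -> s \in C ->
  exists y z, [/\ y \in C, z \in C, y != z, e s y & e s z].
Proof.
move=> /andP[Ce Cu] Cs sC.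
case: (rot_to sC) => i a Ea.
have aC x : x \in a -> x \in C.
  by move=> xa; rewrite -(mem_rot i) Ea inE xa orbT.
move: Ce Cu Cs; rewrite -(rot_cycle i) -(rot_uniq i) -(size_rot i) Ea.
case: a Ea aC => // y [|z a] // _ aC /= /andP[sy].
rewrite rcons_path => /and3P[_ _ slast] /and3P[_ ya _] _.
rewrite e_sym in slast.
exists y, (last z a); split=> //; first by rewrite aC ?inE ?eqxx.
- by rewrite aC // inE mem_last orbT.
- by apply: contraNneq ya => ->; rewrite mem_last.
Qed.

Lemma cycle_path (C : seq V) s c : ucycleb e C -> s \in C -> c \in C ->
  exists v, [/\ path e s v, last s v = c & {subset v <= C}].
Proof.
move=> /andP[Ce _] sC cC.
case: (rot_to sC) => i a Ea.
have aC x : x \in s :: a -> x \in C.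
  by move=> xa; rewrite -(mem_rot i) Ea.
have ca : c \in s :: a by rewrite -Ea mem_rot.
move: Ce; rewrite -(rot_cycle i) Ea /= rcons_path => /andP[sa _].
clear Ea; move: sa aC; case/splitPl: ca => a1 a2 a1c sa aC.
exists a1; split=> //; first by move: sa; rewrite cat_path => /andP[].
by move=> x xa; rewrite aC // inE mem_cat xa orbT.
Qed.

(** Rotate [C] to [x a1 y a2]. The edge from [y] to [x] closes [x a1 y] into a cycle, which is
    proper and shorter than [C] unless [a1] or [a2] is empty; these are the first two cases. *)
Lemma cycle_chord (C : seq V) x y : ucycleb e C -> x \in C -> y \in C -> e x y ->
  [\/ y = next C x, x = next C y
    | exists D, [/\ ucycleb e D, 2 < size D & size D < size C]].
Proof.
move=> /andP[Ce Cu] xC yC xy.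
case: (rot_to xC) => i a Ea.
rewrite -!(next_rot i Cu) -(size_rot i C).
move: Ce Cu; rewrite -(rot_cycle i) -(rot_uniq i) => Ce Cu.
have : y \in x :: a by rewrite -Ea mem_rot.
rewrite Ea in Ce Cu *; rewrite inE => /predU1P[yx|ya].
  by rewrite yx e_irr in xy.
clear Ea; move: Ce Cu; case/splitPr: ya => a1 a2 Ce Cu.
case: a1 => [|z a1] in Ce Cu *.
  by apply: Or31; rewrite /= eqxx.
case: a2 => [|t a2] in Ce Cu *.
  apply: Or32; rewrite next_nth inE mem_cat !inE eqxx !orbT.
  have yn : y \notin x :: z :: a1.
    by move: Cu; rewrite -!cat_cons cats1 rcons_uniq => /andP[].
  rewrite -cat_cons index_cat (negPf yn) /= eqxx addn0.
  (* The last entry has an index outside the tail, so [nth] returns its default, the head [x]: this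
     is the wrap-around of [next]. *)
  by rewrite nth_default // size_cat addn1.
apply: Or33; exists (x :: z :: a1 ++ [:: y]); split.
- apply/andP; split.
    move: Ce; rewrite /= !rcons_cat !cat_path /=.
    by case/and4P=> -> -> -> _; rewrite e_sym xy.
  move: Cu; rewrite -(cat1s y) (catA (z :: a1)) -(cat_cons x) cat_uniq.
  by case/andP.
- by rewrite /= size_cat addn1.
- by rewrite /= !size_cat /= !ltnS ltn_add2l.
Qed.

(** By minimality a chord is impossible, so every edge joins consecutive entries of [C], and [index]
    is the isomorphism. *)
Lemma hamiltonian_min_cycle (C : seq V) : ucycleb e C -> 2 < size C ->
  (forall D, ucycleb e D -> 2 < size D -> size C <= size D) ->
  (forall x, x \in C) -> is_cycle_graph e.
Proof.
move=> Ce Cs Cmin CV; have /andP[Cc Cu] := Ce.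
exists (size C) => //.
have Ci x : index x C < size C by rewrite index_mem.
have nextE x y : (index y C == (index x C).+1 %% size C) = (y == next C x).
  have -> : next C x = nth x C ((index x C).+1 %% size C).
    rewrite next_nth CV; case: (C) Cs (Ci x) => // y0 C' _ Cx.
    have [xl|xl] := ltnP (index x (y0 :: C')).+1 (size (y0 :: C')).
      by rewrite modn_small //=; apply: set_nth_default.
    have -> : (index x (y0 :: C')).+1 = size (y0 :: C').
      by apply/eqP; rewrite eqn_leq xl Cx.
    by rewrite modnn nth_default.
  have jC : (index x C).+1 %% size C < size C by rewrite ltn_mod (leq_trans _ Cs).
  apply/eqP/eqP => [<-|->]; first by rewrite nth_index.
  by rewrite index_uniq.
exists (fun x => Ordinal (Ci x)).
  have [x0 _] : exists x0, x0 \in C.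
    by case: (C) Cs => // x0 C' _; exists x0; rewrite inE eqxx.
  exists (fun i : 'I_(size C) => nth x0 C i) => [x|i] /=; first by rewrite nth_index.
  by apply: val_inj; rewrite /= index_uniq.
move=> x y; rewrite /cycle_adj -!val_eqE /= !nextE.
apply/idP/idP => [/orP[]/eqP->|xy]; first exact: next_cycle.
  by rewrite e_sym next_cycle.
case: (cycle_chord Ce (CV x) (CV y) xy) => [->|->|[D [De Ds]]].
- by rewrite eqxx.
- by rewrite eqxx orbT.
- by rewrite ltnNge Cmin.
Qed.

Lemma cycle_missing_vertex : connected_graph e -> ~ is_tree e -> ~ is_cycle_graph e ->
  exists (C : seq V) (p : V), [/\ ucycleb e C, 2 < size C & p \notin C].
Proof.
move=> econn etree ecyc.
have [C0 [C0e C0s]] : exists C, ucycleb e C /\ 2 < size C.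
  apply: contrapT => noC; apply: etree; split=> // C Cs; apply/negP => Ce.
  by apply: noC; exists C.
pose P n := `[< exists C, [/\ ucycleb e C, 2 < size C & size C = n] >].
have exP : exists n, P n by exists (size C0); apply/asboolP; exists C0.
case: (ex_minnP exP) => n /asboolP[C [Ce Cs Cn]] nmin.
apply: contrapT => noC; apply: ecyc; apply: (hamiltonian_min_cycle Ce Cs) => [D De Ds|x].
  by rewrite Cn; apply: nmin; apply/asboolP; exists D.
by apply: contrapT => /negP xC; apply: noC; exists C, x.
Qed.

End Cycles.

(** * Dodging on a cycle, answers and closed tours *)

Section Tour.
Local Open Scope nat_scope.
Variables (V : finType) (e : rel V).
Hypotheses (e_sym : symmetric e) (e_irr : irreflexive e).
Hypothesis e_conn : forall x y, connect e x y.
Variable C : seq V.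
Hypotheses (Ce : ucycleb e C) (Cs : 2 < size C).

Lemma evade_on_cycle u r s : s \in C -> r != s ->
  exists v, [/\ path e s v, {subset v <= C} & evades r s u v].
Proof.
elim: u r s => [|r' u IHu] r s sC rs.
  by exists [::]; split=> //; apply: EvadesNil.
have [r's|r's] := eqVneq r' s; last first.
  have [v [sv vC ev]] := IHu r' s sC r's.
  by exists v; split=> //; apply: EvadesFirst.
(* The dodging token moves only when the other one is about to step onto it. It then leaves [s] for
   a neighbour on [C] other than [r], where the other token still stands. *)
have [s' [s'C ss' rs']] : exists s', [/\ s' \in C, e s s' & r != s'].
  have [y [z [yC zC yz sy sz]]] := cycle_two_neighbours e_sym Ce Cs sC.
  have [ry|ry] := eqVneq r y; last by exists y.
  by exists z; rewrite ry.
have r's' : r' != s' by rewrite r's; apply: contraTneq ss' => <-; rewrite e_irr.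
have [v [sv vC ev]] := IHu r' s' s'C r's'.
exists (s' :: v); split; rewrite /= ?ss' //.
  by move=> x; rewrite inE => /predU1P[->|/vC].
by apply: EvadesSecond => //; apply: EvadesFirst.
Qed.

Variables p c : V.
Hypotheses (pC : p \notin C) (cC : c \in C).

(** Dodge [u] on [C], then return to [c] along [C] while the other token rests at [p], off the
    cycle. The clause [p \notin v] allows it to rest at [p] during all of [v]. *)
Lemma answer (u : seq V) : exists v,
  [/\ path e c v, last c v = c, p \notin v & last p u = p -> evades p c u v].
Proof.
have pNc : p != c by apply: contraNneq pC => ->.
have [v1 [cv1 v1C ev]] := evade_on_cycle u cC pNc.
have lC : last c v1 \in C.
  by have := mem_last c v1; rewrite inE => /predU1P[->|/v1C].
have [v2 [v1v2 v2c v2C]] := cycle_path Ce lC cC.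
exists (v1 ++ v2); split.
- by rewrite cat_path cv1.
- by rewrite last_cat.
- by rewrite mem_cat; apply: contra pC => /orP[/v1C|/v2C].
- move=> up; rewrite -[u]cats0; apply: evades_cat => //; rewrite up.
  apply: evades_still; apply: contra pC.
  by rewrite inE => /predU1P[->|/v2C].
Qed.

Lemma closed_tour_of v : exists u w, [/\ path e p u, last p u = p, path e c w,
  last c w = c & evades p c u w /\ v \in c :: w].
Proof.
have pNc : p != c by apply: contraNneq pC => ->.
(* The first token walks to [c] while the second dodges on [C], ending at some [s]. *)
have /connectP[u1 pu1 u1c] := e_conn p c.
have [w1 [cw1 w1C ev1]] := evade_on_cycle u1 cC pNc.
set s := last c w1 in ev1 *.
(* Roles are exchanged: the second token heads for [v] while the first, now on [C], dodges. *)
have /connectP[w2 sw2 w2v] := e_conn s v.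
have sNc : s != c.
  by rewrite eq_sym [X in X != _]u1c evades_last_neq.
have [u2 [cu2 u2C ev2]] := evade_on_cycle w2 cC sNc.
pose u := u1 ++ u2; pose w := w1 ++ w2.
have pu : path e p u by rewrite cat_path pu1 -u1c.
have cw : path e c w by rewrite cat_path cw1.
have ev : evades p c u w.
  by apply: evades_cat => //; rewrite -u1c; apply: evades_sym.
have revP x z : path e x z -> path e (last x z) (rev (belast x z)).
  by rewrite rev_path (eq_path (e' := e)) // => a b; rewrite e_sym.
(* Undoing all moves brings both tokens back to [p] and [c]. *)
exists (u ++ rev (belast p u)), (w ++ rev (belast c w)); split.
- by rewrite cat_path pu revP.
- by rewrite last_cat last_rev_belast.
- by rewrite cat_path cw revP.
- by rewrite last_cat last_rev_belast.
- split; first by apply: evades_cat => //; apply: evades_rev.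
  rewrite -cat_cons mem_cat; apply/orP; left.
  by rewrite w2v -last_cat mem_last.
Qed.

Lemma closed_tour : exists u w, [/\ path e p u, last p u = p, path e c w,
  last c w = c & evades p c u w /\ forall v, v \in c :: w].
Proof.
suff [u [w [? ? ? ? [? H]]]] : exists u w, [/\ path e p u, last p u = p, path e c w,
    last c w = c & evades p c u w /\ {subset enum V <= c :: w}].
  by exists u, w; split=> //; split=> // v; apply: H; rewrite mem_enum.
elim: (enum V) => [|v vs [u [w [pu up cw wc [ev H]]]]].
  exists [::], [::]; split=> //; split=> //; apply: EvadesNil.
  by apply: contraNneq pC => ->.
have [u' [w' [pu' up' cw' wc' [ev' H']]]] := closed_tour_of v.
exists (u ++ u'), (w ++ w'); split.
- by rewrite cat_path pu up.
- by rewrite last_cat up.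
- by rewrite cat_path cw wc.
- by rewrite last_cat wc.
- split; first by apply: evades_cat; rewrite ?up ?wc.
  move=> x; rewrite inE => /predU1P[->|/H]; rewrite -cat_cons mem_cat.
    by move: H'; rewrite inE => /predU1P[->|->]; rewrite ?inE ?eqxx ?orbT.
  by move=> ->.
Qed.

End Tour.

(** * The family of evasive walks *)

Section EvasiveWalk.
Local Open Scope nat_scope.

Definition occurs (V : Type) (x : nat -> V) (p : V) (u : seq V) (a : nat) : Prop :=
  forall i, i <= size u -> x (a + i) = nth p (p :: u) i.

Lemma last_map_iota (T : Type) (x : nat -> T) m k :
  last (x m) [seq x i | i <- iota m.+1 k] = x (m + k).
Proof.
elim: k m => [|k IHk] m /=; first by rewrite addn0.
by rewrite IHk addSnnS.
Qed.

Lemma flatten_closed_path (V : eqType) (e : rel V) (c : V) (ss : seq (seq V)) :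
  {in ss, forall s, path e c s /\ last c s = c} ->
  path e c (flatten ss) /\ last c (flatten ss) = c.
Proof.
elim: ss => //= s ss IHss H.
have [cs sc] := H s (mem_head _ _).
have [|css ssc] := IHss; first by move=> r rs; apply: H; rewrite inE rs orbT.
by rewrite cat_path last_cat sc cs.
Qed.

Variables (V : finType) (e : rel V) (p c : V) (ans : seq V -> seq V).
Hypothesis ansP : forall W, [/\ path e c (ans W), last c (ans W) = c, p \notin ans W
  & last p W = p -> evades p c W (ans W)].
Variables u w : seq V.
Hypotheses (up : last p u = p) (cw : path e c w) (wc : last c w = c).
Hypotheses (uw : evades p c u w) (u0 : 0 < size u) (wV : forall v, v \in c :: w).
Variables y z : V.
Hypotheses (yz : y != z) (yp : y != p) (zp : z != p).
Hypotheses (cy : e c y) (yc : e y c) (cz : e c z) (zc : e z c).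
Variable t : nat -> nat.

Definition all_answers (n : nat) : seq V :=
  flatten [seq ans (val W) | W <- enum {: n.-bseq V}].

(** The bit [b n] is stored in a detour from [c] to one of two neighbours, both different from [p].
    The bound [t n.+1] is the latest time at which the word to be answered can end. *)
Definition preamble (b : nat -> bool) (n : nat) : seq V :=
  [:: if b n then y else z; c] ++ all_answers (t n.+1).

Definition evader (b : nat -> bool) : nat -> V :=
  concat_walk c (fun n => preamble b n ++ w).

Lemma answers_closed (Ws : seq (seq V)) :
  path e c (flatten [seq ans W | W <- Ws]) /\
  last c (flatten [seq ans W | W <- Ws]) = c.
Proof. by apply: flatten_closed_path => s /mapP[W _ ->]; case: (ansP W). Qed.

Lemma p_notin_answers (Ws : seq (seq V)) : p \notin flatten [seq ans W | W <- Ws].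
Proof. by apply/flattenP => -[s /mapP[W _ ->]]; apply/negP; case: (ansP W). Qed.

Lemma preamble_closed b n : path e c (preamble b n) /\ last c (preamble b n) = c.
Proof.
rewrite /preamble /all_answers (map_comp ans val) /=.
have [-> ->] := answers_closed [seq val W | W <- enum {: (t n.+1).-bseq V}].
by case: (b n); rewrite ?cy ?yc ?cz ?zc.
Qed.

Lemma size_block b n : 0 < size (preamble b n ++ w).
Proof. by []. Qed.

Lemma block_closed b n : last c (preamble b n ++ w) = c.
Proof. by rewrite last_cat (preamble_closed b n).2. Qed.

Lemma evader_walk b : is_walk e (evader b).
Proof.
apply: concat_walk_is_walk => [n|n|n]; first exact: size_block.
  exact: block_closed.
by rewrite cat_path !(preamble_closed b n).1 (preamble_closed b n).2.
Qed.

(** Block [n] starts at time [n] or later, and its final tour [w] meets [v]. *)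
Lemma evader_visits b v n : exists2 k, n <= k & evader b k = v.
Proof.
have vi : index v (c :: w) <= size w by rewrite -ltnS index_mem wV.
exists (block_start (fun n => preamble b n ++ w) n +
  (size (preamble b n) + index v (c :: w))).
  by apply: leq_trans (leq_addr _ _); apply: leq_block_start => m; apply: size_block.
rewrite /evader concat_walk_closed_block; first last.
- by rewrite size_cat leq_add2l.
- exact: block_closed.
- exact: size_block.
rewrite -cat_cons; move: (preamble b n) (preamble_closed b n).2 => q qc.
case: (index v (c :: w)) vi (nth_index c (wV v)) => [|i] vi <-.
  rewrite addn0 nth_cat /= ltnS leqnn.
  by rewrite -[size _]/(size (c :: q)).-1 nth_last.
by rewrite nth_cat /= addnS ltnS ltnNge leq_addr /= subSS addnC addnK.
Qed.

(** Block lengths do not depend on the bits, so the bit [b n] is read off at the same time in both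
    walks. *)
Lemma evader_inj : injective evader.
Proof.
move=> b b' E; apply/funext => n.
have S m : block_start (fun n => preamble b n ++ w) m =
           block_start (fun n => preamble b' n ++ w) m.
  by elim: m => // m IHm; rewrite !block_startS IHm !size_cat.
have := congr1 (fun f => f (block_start (fun n => preamble b n ++ w) n + 0).+1) E.
rewrite /evader {2}S !concat_walk_block //=.
by case: (b n); case: (b' n) => // /eqP; rewrite ?(negPf yz) // eq_sym (negPf yz).
Qed.

(** The first token waits at [p] until the answer to [W] comes up, runs through [W] against it,
    waits again during the other answers, and plays [u] against [w]. *)
Lemma evades_block b n W : size W <= t n.+1 -> last p W = p ->
  evades p c (W ++ u) (preamble b n ++ w).
Proof.
move=> Wt Wp; apply: evades_cat; last by rewrite Wp (preamble_closed b n).2.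
have pc : p != c := evades_neq uw.
rewrite -[W]cat0s; apply: evades_cat => /=.
  apply: evades_still; rewrite !inE !negb_or pc andbT /=.
  by case: (b n); rewrite eq_sym.
rewrite /all_answers (map_comp ans val).
have : W \in [seq val W | W <- enum {: (t n.+1).-bseq V}].
  by apply/mapP; exists (Bseq Wt); rewrite ?mem_enum.
case/splitPr => A B; rewrite map_cat flatten_cat -{1}[W]cat0s.
have still Ws : evades p c [::] (flatten [seq ans W | W <- Ws]).
  by apply: evades_still; rewrite inE negb_or pc p_notin_answers.
apply: evades_cat => //=; rewrite (answers_closed A).2 -{1}[W]cats0.
case: (ansP W) => _ Wc _ Wev.
by apply: evades_cat; [apply: Wev | rewrite Wp Wc].
Qed.

Lemma evader_successful b (x : nat -> V) : x 0 = p ->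
  (forall n, exists a, [/\ t n <= a, a + size u <= t n.+1 & occurs x p u a]) ->
  successful x (evader b).
Proof.
move=> x0 /choice[a aP].
(* [E n] is the time at which the walk completes the previous chosen occurrence of [u], or 0 at the
   beginning. *)
pose E n := if n is m.+1 then a m + size u else 0.
have Ea n : E n <= a n.
  case: n => // n; case: (aP n.+1) => ta _ _; apply: leq_trans ta.
  by case: (aP n).
have xE n : x (E n) = p.
  case: n => // n; case: (aP n) => _ _ -> //.
  by rewrite -[RHS]up (last_nth p).
(* What the walk does between two chosen occurrences of [u]: a closed word at [p]. *)
pose W n := [seq x k | k <- iota (E n).+1 (a n - E n)].
have Wp n : last p (W n) = p.
  rewrite -{1}(xE n) last_map_iota subnKC //.
  by case: (aP n) => _ _ /(_ 0 isT); rewrite addn0.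
have Wt n : size (W n) <= t n.+1.
  rewrite size_map size_iota; apply: leq_trans (leq_subr _ _) _.
  by case: (aP n) => _ + _; apply: leq_trans; rewrite leq_addr.
rewrite (@cut_into_words _ x E (fun n => W n ++ u)) ?x0 //.
- apply: evades_successful => n.
  + by rewrite size_cat addn_gt0 u0 orbT.
  + exact: size_block.
  + by rewrite last_cat Wp.
  + exact: block_closed.
  + exact: evades_block.
- by move=> n; apply: leq_ltn_trans (Ea n) _; rewrite /= -addn1 leq_add2l.
move=> n; rewrite [E n.+1]/(a n + size u) -addnBAC // iotaD map_cat.
congr (_ ++ _); rewrite addSn subnKC //.
apply: (@eq_from_nth _ p); rewrite ?size_map ?size_iota // => i iu.
rewrite (nth_map 0) ?size_iota // nth_iota // addSnnS.
by case: (aP n) => _ _ ->.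
Qed.

End EvasiveWalk.

(** * Uncountability *)

Lemma uncountable_of_bits (T : Type) (A : set T) (f : (nat -> bool) -> T) :
  injective f -> (forall b, A (f b)) -> ~ countable A.
Proof.
move=> f_inj fA /countable_injP[g g_inj].
have gf_inj b b' : g (f b) = g (f b') -> b = b'.
  by move=> /g_inj E; apply: f_inj; apply: E; rewrite inE.
(* Cantor's diagonal sequence: at [n = g (f b')] it differs from [b']. *)
pose b n := ~~ `[< exists b', g (f b') = n /\ b' n >].
have := erefl (b (g (f b))); rewrite {1}/b.
case: asboolP => /= [[b' [/gf_inj ->]] ->//|H bt].
by apply: H; exists b; split; rewrite -?bt.
Qed.

(** * Occurrences of a word in a sequence *)

Section Occurrences.
Local Open Scope nat_scope.
Variable V : Type.
Implicit Types (x : nat -> V) (v : V) (z : seq V).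

Lemma occurs_nil x v N : occurs x v [::] N <-> x N = v.
Proof.
split=> [/(_ 0 isT)|xN [|//] _]; by rewrite addn0.
Qed.

Lemma occurs_cons x v a z N : occurs x v (a :: z) N <-> x N = v /\ occurs x a z N.+1.
Proof.
split=> [H|[xN H] [|i] iz]; last 2 first.
- by rewrite addn0.
- rewrite addnS -addSn H //=; case: i iz => //= i iz.
  exact: set_nth_default.
split; first by have := H 0 isT; rewrite addn0.
move=> i iz; rewrite addSnnS H //=; case: i iz => //= i iz.
exact: set_nth_default.
Qed.

Lemma occurs_cat x v z z' N : occurs x v (z ++ z') N ->
  occurs x (last v z) z' (N + size z).
Proof.
elim: z v N => [|a z IHz] v N /=; first by rewrite addn0.
by case/occurs_cons=> _ /IHz; rewrite addSnnS.
Qed.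

Definition missed (v : V) z (t N : nat) x : Prop :=
  ~ exists a, [/\ t <= a, a + size z <= N & occurs x v z a].

(** The analogue of membership in the sigma-algebra generated by the positions up to time [N]. *)
Definition determined N (Q : (nat -> V) -> Prop) : Prop :=
  forall x x', (forall i, i <= N -> x i = x' i) -> Q x -> Q x'.

Lemma missed_determined v z t N : determined N (missed v z t N).
Proof.
move=> x x' xx' H [a [ta aN o]]; apply: H; exists a; split=> // i iz.
by rewrite xx' ?o // (leq_trans _ aN) // leq_add2l.
Qed.

End Occurrences.

Import Order.TTheory GRing.Theory Num.Theory.

(** * Occurrences of a word in a random walk *)

Section RandomWalkOccurrences.
Local Open Scope ring_scope.
Variables (R : realType) (d : measure_display) (Omega : measurableType d).
Variables (P : probability Omega R) (V : finType) (e : rel V).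
Variable X : nat -> Omega -> V.
Hypothesis hX : random_walk P e X.

Let path_of (w : Omega) : nat -> V := fun n => X n w.

Let cylinder N (h : nat -> V) : set Omega :=
  [set w | forall i, (i <= N)%N -> X i w = h i].

Lemma cylinder_measurable N h : measurable (cylinder N h).
Proof.
have -> : cylinder N h = \bigcap_(i in [set i | (i <= N)%N]) [set w | X i w = h i].
  by apply/seteqP; split=> w.
by apply: bigcap_measurable => [|i _]; [exists 0%N | case: hX].
Qed.

(** Past [N] the values are junk, as [inord] falls back to 0; cylinders and determined predicates
    read only indices up to [N]. *)
Let extend N (h : {ffun 'I_N.+1 -> V}) : nat -> V := fun i => h (inord i).

Lemma cylinder_extend N w : exists h : {ffun 'I_N.+1 -> V}, cylinder N (extend h) w.
Proof.
by exists [ffun i : 'I_N.+1 => X i w] => i iN; rewrite /extend ffunE inordK.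
Qed.

Lemma determined_bigcup N Q A : determined N Q ->
  [set w | Q (path_of w)] `&` A =
  \bigcup_(h in [set h : {ffun 'I_N.+1 -> V} | Q (extend h)])
    (cylinder N (extend h) `&` A).
Proof.
move=> QN; apply/seteqP; split=> [w [Qw Aw]|w [h Qh [hw Aw]]]; last first.
  by split=> //; apply: QN Qh => i /hw.
have [h hw] := cylinder_extend N w; exists h => //=.
by apply: QN Qw => i /hw.
Qed.

Lemma cylinder_trivIset N (D : set {ffun 'I_N.+1 -> V}) (A : set Omega) :
  trivIset D (fun h => cylinder N (extend h) `&` A).
Proof.
move=> h h' _ _ [w [[hw _] [h'w _]]]; apply/ffunP => i.
have iN : (i <= N)%N by rewrite -ltnS.
by have := hw i iN; rewrite (h'w i iN) /extend inord_val.
Qed.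

Lemma determined_measurable N Q : determined N Q ->
  measurable [set w | Q (path_of w)].
Proof.
move=> QN; rewrite -[X in measurable X]setIT (determined_bigcup _ QN).
apply: fin_bigcup_measurable => [|h _]; first exact: finite_finset.
rewrite setIT; exact: cylinder_measurable.
Qed.

Let q : R := #|V|%:R^-1.

(** Each prescribed step along an edge has conditional probability 1/degree, which is at least
    [q]. *)
Lemma cylinder_occurs_ge N h z : path e (h N) z ->
  ((q ^+ size z)%:E * P (cylinder N h) <=
   P (cylinder N h `&` [set w | occurs (path_of w) (h N) z N]))%E.
Proof.
elim: z N h => [|a z IHz] N h /=.
  move=> _; rewrite expr0 mul1e le_eqVlt; apply/orP; left; apply/eqP; congr (P _).
  by apply/seteqP; split=> [w hw|w []] //; split=> //; apply/occurs_nil/hw.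
case/andP=> ha az.
pose h' i := if (i <= N)%N then h i else a.
have h'N : h' N.+1 = a by rewrite /h' ltnn.
have cylE : cylinder N.+1 h' = [set w | cylinder N h w /\ X N.+1 w = a].
  apply/seteqP; split=> [w hw|w [hw wa] i].
    by split=> [i iN|]; rewrite hw // /h' ?iN ?ltnn // ltnW.
  rewrite /h' leq_eqVlt ltnS; case: (leqP i N) => [iN _|_]; first exact: hw.
  by rewrite orbF => /eqP->.
have -> : cylinder N h `&` [set w | occurs (path_of w) (h N) (a :: z) N] =
          cylinder N.+1 h' `&` [set w | occurs (path_of w) (h' N.+1) z N.+1].
  rewrite h'N cylE; apply/seteqP; split=> [w [hw /occurs_cons[_ oz]]|w [[hw wa] oz]].
    split=> //; split=> //.
    by have := oz 0%N isT; rewrite addn0.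
  by split=> //; apply/occurs_cons; split=> //; apply: hw.
apply: le_trans (IHz N.+1 h' _); last by rewrite h'N.
rewrite cylE; case: hX => _ _ ->; rewrite ha exprSr EFinM -muleA.
apply: lee_wpmul2l; first by rewrite lee_fin exprn_ge0 // invr_ge0 ler0n.
rewrite muleC; apply: lee_wpmul2l => //.
rewrite lee_fin lef_pV2 ?posrE ?ltr0n ?ler_nat ?max_card //.
  by apply/card_gt0P; exists a; rewrite inE.
by apply/card_gt0P; exists a.
Qed.

Variables (p : V) (u : seq V) (B : nat) (hit : V -> seq V).
Hypothesis hit_path : forall v, path e v (hit v).
Hypothesis hit_size : forall v, (size (hit v) <= B)%N.
Hypothesis hit_cat : forall v, exists2 r, hit v = r ++ u & last v r = p.

Let V_gt0 : (0 < #|V|)%N.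
Proof. by apply/card_gt0P; exists p. Qed.

Let hits N : set Omega :=
  [set w | occurs (path_of w) (X N w) (hit (X N w)) N].

Lemma hits_measurable N : measurable (hits N).
Proof.
apply: (@determined_measurable (N + B)%N
  (fun x => occurs x (x N) (hit (x N)) N)) => x x' xx' o i iz.
have xN : x N = x' N by rewrite xx' ?leq_addr.
rewrite -xN in iz *; rewrite -xx'; first exact: o.
by rewrite leq_add2l (leq_trans iz) // hit_size.
Qed.

(** Whatever happened up to time [N], the walk follows [hit] from its current position with
    conditional probability at least [q ^+ B]. Summing over the finitely many cylinders in [Q] gives
    the bound. *)
Lemma determined_hits_ge N Q : determined N Q ->
  ((q ^+ B)%:E * P [set w | Q (path_of w)] <=
   P ([set w | Q (path_of w)] `&` hits N))%E.
Proof.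
move=> QN.
have PE A : measurable A -> P ([set w | Q (path_of w)] `&` A) =
    (\sum_(h \in [set h : {ffun 'I_N.+1 -> V} | Q (extend h)])
       P (cylinder N (extend h) `&` A))%E.
  move=> mA; rewrite (determined_bigcup _ QN) measure_fin_bigcup //.
  - exact: finite_finset.
  - exact: cylinder_trivIset.
  - by move=> h _; apply: measurableI => //; apply: cylinder_measurable.
rewrite -[X in (_ * P X <= _)%E]setIT !PE //; last exact: hits_measurable.
rewrite ge0_mule_fsumr; last by move=> h; apply: measure_ge0.
apply: lee_fsum => [|h _]; first exact: finite_finset.
rewrite setIT.
have -> : cylinder N (extend h) `&` hits N = cylinder N (extend h) `&`
    [set w | occurs (path_of w) (extend h N) (hit (extend h N)) N].
  apply/seteqP; split=> w [hw]; rewrite /hits /= (hw N (leqnn N)) //.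
apply: le_trans (cylinder_occurs_ge (hit_path _)).
apply: lee_wpmul2r => //; rewrite lee_fin ler_wiXn2l ?invr_ge0 ?ler0n //.
by rewrite invf_le1 ?ltr0n // ler1n.
Qed.

Let missed_measurable t N : measurable [set w | missed p u t N (path_of w)].
Proof. exact: determined_measurable (@missed_determined _ p u t N). Qed.

(** Time after [t] is cut into [m] stretches of length [B]; given the past, each misses [u] with
    probability at most [1 - q ^+ B]. *)
Lemma missed_le_expr t m :
  fine (P [set w | missed p u t (t + B * m) (path_of w)]) <= (1 - q ^+ B) ^+ m.
Proof.
have q01 : 0 <= q ^+ B <= 1.
  rewrite exprn_ge0 ?invr_ge0 ?ler0n //= exprn_ile1 ?invr_ge0 ?ler0n //.
  by rewrite invf_le1 ?ltr0n // ler1n.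
elim: m => [|m IHm].
  by rewrite expr0 -lee_fin fineK ?fin_num_measure ?probability_le1.
set N := (t + B * m)%N in IHm.
pose F := [set w | missed p u t N (path_of w)].
pose F' := [set w | missed p u t (t + B * m.+1) (path_of w)].
have mF : measurable F by exact: missed_measurable.
have mF' : measurable F' by exact: missed_measurable.
have NB : (t + B * m.+1 = N + B)%N by rewrite /N mulnS addnA addnAC.
(* Following [hit] from time [N] would produce [u] at time [N + size r], before the stretch ends. *)
have F'F : F' `<=` F `\` hits N.
  move=> w; rewrite /F' NB => F'w; split=> [[a [ta aN o]]|o].
    by apply: F'w; exists a; split=> //; apply: leq_trans aN (leq_addr _ _).
  apply: F'w; have [r rE rp] := hit_cat (X N w).
  exists (N + size r)%N; split.
  - by rewrite (leq_trans (leq_addr (B * m) t)) // leq_addr.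
  - by rewrite -addnA leq_add2l -size_cat -rE.
  - by move: o; rewrite /hits /= rE -rp; apply: occurs_cat.
have le1 : (P F' <= P (F `\` hits N))%E.
  by apply: le_measure; rewrite ?inE //; apply: measurableD => //; apply: hits_measurable.
have mFH : measurable (F `&` hits N) by apply: measurableI => //; apply: hits_measurable.
have mFD : measurable (F `\` hits N) by apply: measurableD => //; apply: hits_measurable.
have E : fine (P F) = fine (P (F `\` hits N)) + fine (P (F `&` hits N)).
  by rewrite (measureDI P mF (hits_measurable N)) fineD ?fin_num_measure.
have le2 := determined_hits_ge (@missed_determined _ p u t N).
rewrite -/F -(fineK (fin_num_measure P _ mF)) -(fineK (fin_num_measure P _ mFH)) in le2.
rewrite -(fineK (fin_num_measure P _ mF')) -(fineK (fin_num_measure P _ mFD)) in le1.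
rewrite -EFinM !lee_fin in le1 le2.
rewrite -/F' exprS; apply: le_trans le1 _.
apply: le_trans (ler_wpM2l _ IHm); last by rewrite subr_ge0; case/andP: q01.
by rewrite mulrBl mul1r lerBrDr {2}E lerD2l.
Qed.

(** Union bound: the walk starts at [p] with probability [q], while the failures for all [n]
    together cost at most [q / 2]. *)
Lemma occurrences_positive (t : nat -> nat) (m : nat -> nat) :
  (forall n, t n.+1 = t n + B * m n)%N ->
  (forall n, (1 - q ^+ B) ^+ m n <= (q / 2) / (2 ^ n.+1)%:R) ->
  positive_probability P [set w | X 0%N w = p /\ forall n, exists a,
    [/\ (t n <= a)%N, (a + size u <= t n.+1)%N & occurs (path_of w) p u a]].
Proof.
move=> tE mE.
pose F n := [set w | missed p u (t n) (t n.+1) (path_of w)].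
have mF n : measurable (F n) by exact: missed_measurable.
have mFU : measurable (\bigcup_n F n) by exact: bigcup_measurable.
pose A := [set w | X 0%N w = p].
have [mX PX _] := hX.
have mA : measurable A by exact: mX.
exists (A `\` \bigcup_n F n); split; first exact: measurableD.
  move=> w [Aw Fw]; split=> // n; apply: contrapT => H; apply: Fw; by exists n.
have q0 : 0 < q by rewrite invr_gt0 ltr0n.
have PF : (P (\bigcup_n F n) <= (q / 2)%:E)%E.
  (* The bounds [(q / 2) / 2 ^ n.+1] sum to [q / 2]. *)
  apply: le_trans (epsilon_trick0 xpredT _); last by rewrite divr_ge0 // ltW.
  apply: le_trans (measure_sigma_subadditive P mF mFU (@subset_refl _ _)) _.
  apply: lee_nneseries => n _ //.
  have := missed_le_expr (t n) (m n).
  rewrite -tE -lee_fin fineK ?fin_num_measure // => /le_trans; apply.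
  by rewrite lee_fin.
have E := measureDI P mA mFU.
have PI : (P (A `&` \bigcup_n F n) <= (q / 2)%:E)%E.
  by apply: le_trans PF; apply: measureIr.
rewrite ltNge; apply/negP => P0.
have : (P A <= 0 + (q / 2)%:E)%E by rewrite E leeD.
rewrite PX -/q add0e lee_fin ler_pdivlMr // mulr2n mulrDr mulr1.
by rewrite -subr_ge0 opprD addNKr oppr_ge0 leNgt q0.
Qed.

End RandomWalkOccurrences.

(** * Choice of the time scale and conclusion *)

Lemma geometric_decay (R : realType) (q : R) (eps : nat -> R) :
  (0 < q)%R -> (q <= 1)%R -> (forall n, (0 < eps n)%R) ->
  exists m : nat -> nat, forall n, ((1 - q) ^+ m n <= eps n)%R.
Proof.
move=> q0 q1 eps0.
suff /choice[m mP] : forall n, exists m, ((1 - q) ^+ m <= eps n)%R by exists m.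
move=> n; have q'1 : (`|1 - q| < 1)%R.
  by rewrite ger0_norm ?subr_ge0 // ltrBlDr ltrDl.
have [m _ /(_ m (leqnn m)) /= mE] := cvgr_lt _ (cvg_expr q'1) _ (eps0 n).
by exists m; apply: ltW.
Qed.

Theorem theorem2p8 (R : realType) (V : finType) (e : rel V)
    (e_simple : simple_graph e) (e_connected : connected_graph e)
    (e_not_tree : ~ is_tree e) (e_not_cycle : ~ is_cycle_graph e)
    (e_not_Y : forall a b c : nat, ~ graph_isomorphic e (@Y_adj a b c)) :
  ~ countable [set S : nat -> V |
      [/\ is_walk e S, evasive R e S
        & forall (v : V) (n : nat), exists2 k : nat, (n <= k)%N & S k = v]].
Proof.
have [e_sym e_irr] := e_simple; have [V_gt0 e_conn] := e_connected.
have [C [p [Ce Cs pC]]] :=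
  cycle_missing_vertex e_sym e_irr e_connected e_not_tree e_not_cycle.
have [c cC] : exists c, c \in C.
  by case: C Cs {Ce pC} => // c C _; exists c; rewrite inE eqxx.
have pNc : p != c by apply: contraNneq pC => ->.
have [y [z [yC zC yz cy cz]]] := cycle_two_neighbours e_sym Ce Cs cC.
have yp : y != p by apply: contraNneq pC => <-.
have zp : z != p by apply: contraNneq pC => <-.
have yc : e y c by rewrite e_sym.
have zc : e z c by rewrite e_sym.
have /choice[ans ansP] := answer e_sym e_irr Ce Cs pC cC.
have [u [w [pu up cw wc [uw wV]]]] := closed_tour e_sym e_irr e_conn Ce Cs pC cC.
(* With [u] empty, the tour would have to avoid [p], but it visits every vertex. *)
have u0 : (0 < size u)%N.
  case: (u) uw => // /evades_nil_notin; by rewrite wV.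
have /choice[r rP] : forall v, exists r, path e v r /\ last v r = p.
  by move=> v; have /connectP[r vr rp] := e_conn v p; exists r.
(* From any vertex, go to [p] and then perform [u]. *)
pose hit v := r v ++ u.
pose B := (\max_v size (hit v))%N.
have hit_size v : (size (hit v) <= B)%N by exact: leq_bigmax.
have hit_path v : path e v (hit v).
  by rewrite cat_path; have [-> ->] := rP v.
have hit_cat v : exists2 s, hit v = s ++ u & last v s = p.
  by exists (r v) => //; case: (rP v).
pose q : R := (#|V|%:R^-1)%R.
have q0 : (0 < q)%R by rewrite invr_gt0 ltr0n.
have q1 : (q <= 1)%R by rewrite invf_le1 ?ltr0n // ler1n.
(* The time scale depends only on [q] and [B], so a single walk serves all probability spaces and
   all random walks [X]. *)
have [|||m mE] := @geometric_decay R (q ^+ B)%R (fun n => (q / 2) / (2 ^ n.+1)%:R)%R.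
- exact: exprn_gt0.
- by apply: exprn_ile1 => //; apply: ltW.
- by move=> n; rewrite !divr_gt0 // ltr0n expn_gt0.
pose t n := (\sum_(i < n) B * m i)%N.
have tE n : t n.+1 = (t n + B * m n)%N by rewrite /t big_ord_recr.
apply: (uncountable_of_bits (@evader_inj _ c ans w y z yz t)).
move=> b; split.
- exact: evader_walk.
- move=> d Omega P X hX.
  have [E [mE' EX PE]] := occurrences_positive hX hit_path hit_size hit_cat tE mE.
  exists E; split=> // x /EX[x0 xE].
  exact: (evader_successful ansP up wc uw u0 yp zp cy yc cz zc b x0 xE).
- move=> v n; exact: (evader_visits ansP wc wV cy yc cz zc).
Qed.
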